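(* Let $F$ be a free group (of arbitrary rank) and let $H\le F$ be a finitely generated malnormal subgroup. Then $H$ almost has CEP (as a subgroup of $F$).
   Context: For a subgroup $N$ of $G$, $N^G$ denotes the normal closure of $N$ in $G$. A subgroup $H$ of a group $G$ almost has CEP (Congruence Extension Property) if there is a finite set of non-trivial elements $\mathcal F\subseteq H$ such that $H\cap N^G=N$ for every $N\lhd H$ with $N\cap\mathcal F=\emptyset$. A subgroup $H\le G$ is malnormal if $H^g\cap H=\{1\}$ for all $g\in G\setminus H$, where $H^g$ is the conjugate of $H$ by $g$. *)

(* Defs.v *)
From HB Require Import structures.
From mathcomp Require Import all_boot.
From mathcomp Require Import boolp classical_sets functions cardinality.

Set Implicit Arguments.
Unset Strict Implicit.
Unset Printing Implicit Defensive.

Local Open Scope classical_set_scope.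
Local Open Scope group_scope.

(* Subgroups are Prop-valued sets of elements of a possibly infinite group;
   x ^ g is the conjugate g^-1 * (x * g). *)

Definition is_subgroup (G : groupType) (H : set G) : Prop :=
  [/\ H 1, (forall x y, H x -> H y -> H (x * y)) & (forall x, H x -> H x^-1)].

Definition is_normal (G : groupType) (N H : set G) : Prop :=
  [/\ is_subgroup N, N `<=` H & forall n h, N n -> H h -> N (n ^ h)].

Definition subgroup_generated (G : groupType) (S : set G) : set G :=
  smallest (@is_subgroup G) S.

Definition finitely_generated (G : groupType) (H : set G) : Prop :=
  exists S : set G, finite_set S /\ H = subgroup_generated S.

Definition normal_closure (G : groupType) (N : set G) : set G :=
  smallest (fun M => is_normal M [set: G]) N.

Definition malnormal (G : groupType) (H : set G) : Prop :=
  forall g, ~ H g -> [set h ^ g | h in H] `&` H = [set 1].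

Definition almost_CEP (G : groupType) (H : set G) : Prop :=
  exists E : set G,
    [/\ finite_set E, E `<=` H, ~ E 1 &
        forall N : set G, is_normal N H -> N `&` E = set0 ->
          H `&` normal_closure N = N].

(* B is a basis of F: every map from B to a group K extends uniquely to a
   homomorphism from F to K (between groups, multiplicativity suffices). *)
Definition free_basis (F : groupType) (B : set F) : Prop :=
  forall (K : groupType) (f : B -> K),
    exists phi : {multiplicative F -> K},
      (forall b : B, phi (\val b) = f b) /\
      (forall psi : {multiplicative F -> K},
         (forall b : B, psi (\val b) = f b) -> psi =1 phi).

Definition free_group (F : groupType) : Prop := exists B : set F, free_basis B.

(* Main.v *)
Require Import Defs.
From HB Require Import structures.
From mathcomp Require Import all_boot.
From mathcomp Require Import boolp classical_sets functions cardinality.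
From mathcomp Require Import zify.

(** Let [T] be the Cayley tree of [F] with respect to a basis, and let [Y] be the
    convex hull of [H] in [T], a subtree on which [H] acts with finitely many
    orbits of points ([hull_generated]). Its translates by [F] are indexed by
    the left cosets of [H]. If two different translates shared a long segment,
    the pigeonhole principle would give a nontrivial element of two different
    conjugates of [H]; malnormality forbids it, so overlaps of different
    translates have length at most some [L] ([coset_overlap]).

    Let [K] be normal in [H]. The conjugate [K ^ a^-1] acts on the translate of
    [Y] indexed by the coset [aH] as a group of rotations. As balls of [H] are
    finite ([generated_ball_finite]), only finitely many elements of [H] move a
    representative of one of these orbits by at most [5 * L + 2]; the nontrivial
    ones form the exceptional set. When [K] avoids it, every nontrivial rotation
    moves every point of its translate much further than any overlap, which is
    small cancellation in a tree.

    The group generated by all rotations contains the normal closure of [K].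
    The heart of the proof ([rotations_faithful]) is that an element of it which
    stabilizes a translate already lies in the rotation group of that translate;
    applied to the base translate it gives that [H] meets the normal closure
    only in [K]. It is proved by growing a windmill: a subtree [W] with a group
    [G] of rotations acting on it, which contains entirely, with their
    rotations, the translates in some set [A], and meets the others in at most
    [2 * L]. One thickens [W] by one edge, adjoins all translates that are now
    touched, and takes the orbit under the group generated by [G] and the new
    rotations. A touched translate meets the thickened tree in a set of diameter
    at most [2 * L + 2], while its rotations move points by more than
    [5 * L + 2]; so the new rotations play ping-pong on the projections to the
    touched translates ([pong]), every element of the new group has a reduced
    form, and the properties of a windmill persist ([next_windmill]). All
    touched translates are adjoined simultaneously: the bound [2 * L] then does
    not deteriorate from one stage to the next. As the windmills exhaust the
    tree, every translate and every rotation is eventually reached. *)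

Set Implicit Arguments.
Unset Strict Implicit.
Unset Printing Implicit Defensive.

Local Open Scope classical_set_scope.
Local Open Scope group_scope.

(** * The group of bijections of a type *)

Section Bijections.
Variable X : Type.

Record bijection := Bijection {
  bij_fun :> X -> X;
  bij_inv : X -> X;
  bij_funK : cancel bij_fun bij_inv;
  bij_invK : cancel bij_inv bij_fun }.

Lemma bijection_ext (f g : bijection) : f =1 g -> f = g.
Proof.
case: f g => [f f' fK f'K] [g g' gK g'K] /= /funext fg.
move: fK f'K gK g'K; rewrite -{}fg => fK f'K gK g'K.
have fg' : f' = g' by apply/funext => x; rewrite -{1}[x]g'K fK.
by move: gK g'K; rewrite -fg' => gK g'K; congr Bijection; exact: Prop_irrelevance.
Qed.

HB.instance Definition _ := gen_eqMixin bijection.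
HB.instance Definition _ := gen_choiceMixin bijection.

Definition bij_one := @Bijection id id (fun=> erefl) (fun=> erefl).

Definition bij_mul (f g : bijection) : bijection :=
  Bijection (can_comp (bij_funK f) (bij_funK g))
            (can_comp (bij_invK g) (bij_invK f)).

Definition bij_opp (f : bijection) : bijection :=
  Bijection (bij_invK f) (bij_funK f).

Lemma bij_mulA : associative bij_mul.
Proof. by move=> f g h; exact: bijection_ext. Qed.
Lemma bij_mul1g : left_id bij_one bij_mul.
Proof. by move=> f; exact: bijection_ext. Qed.
Lemma bij_mulg1 : right_id bij_one bij_mul.
Proof. by move=> f; exact: bijection_ext. Qed.
Lemma bij_mulVg : left_inverse bij_one bij_opp bij_mul.
Proof. by move=> f; apply: bijection_ext => x /=; rewrite bij_funK. Qed.
Lemma bij_mulgV : right_inverse bij_one bij_opp bij_mul.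
Proof. by move=> f; apply: bijection_ext => x /=; rewrite bij_invK. Qed.

HB.instance Definition _ := isGroup.Build bijection
  bij_mulA bij_mul1g bij_mulg1 bij_mulVg bij_mulgV.
End Bijections.

(** * Reduced words in a free group *)

Section FreeGroupWords.
Variables (F : groupType) (B : set F).

Definition letter := (B * bool)%type.
HB.instance Definition _ := Choice.on letter.

Definition flip (a : letter) : letter := (a.1, ~~ a.2).

Definition letter_val (a : letter) : F :=
  if a.2 then \val a.1 else (\val a.1)^-1.

Definition word (w : seq letter) : F :=
  foldr (fun a x => letter_val a * x) 1 w.

Definition reduced (w : seq letter) : bool :=
  sorted (fun a b => b != flip a) w.

Definition push (a : letter) (w : seq letter) : seq letter :=
  if w is b :: w' then if b == flip a then w' else a :: w else [:: a].

Lemma flipK : involutive flip.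
Proof. by case=> b s; rewrite /flip /= negbK. Qed.

Lemma flip_neq a : (flip a == a) = false.
Proof. by case: a => b s; rewrite /flip xpair_eqE /= eqxx /=; case: s. Qed.

Lemma letter_val_flip a : letter_val (flip a) = (letter_val a)^-1.
Proof. by case: a => b [] //=; rewrite /letter_val /= invgK. Qed.

Lemma word_cat u v : word (u ++ v) = word u * word v.
Proof. by elim: u => [|a u IH] /=; rewrite ?mul1g // IH mulgA. Qed.

Lemma word_push a w : word (push a w) = letter_val a * word w.
Proof.
case: w => [|b w] //=; case: eqP => //= ->.
by rewrite letter_val_flip mulVKg.
Qed.

Lemma reduced_push a w : reduced w -> reduced (push a w).
Proof.
case: w => [|b w] //= rw; case: ifP => [_|/= ->//].
exact: path_sorted rw.
Qed.

Lemma push_reduced a w : reduced (a :: w) -> push a w = a :: w.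
Proof. by case: w => [|b w] //= /andP[/negPf->]. Qed.

Lemma pushK a w : reduced w -> push (flip a) (push a w) = w.
Proof.
case: w => [|b w] rw; first by rewrite /= flipK eqxx.
rewrite /=; case: eqP => [->{b}|_] in rw *; first exact: push_reduced.
by rewrite /= flipK eqxx.
Qed.

Definition wordV (w : seq letter) : seq letter := rev (map flip w).

Lemma word_wordV w : word (wordV w) = (word w)^-1.
Proof.
elim: w => [|a w IH]; first by rewrite /= invg1.
by rewrite /wordV /= rev_cons -cats1 word_cat IH /= mulg1 letter_val_flip invgM.
Qed.

Lemma reduced_wordV w : reduced (wordV w) = reduced w.
Proof.
rewrite /wordV /reduced rev_sorted sorted_map; case: w => [|x w] //=.
by apply: eq_path => a b /=; rewrite flipK eq_sym -(inj_eq (inv_inj flipK)) flipK.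
Qed.

Lemma reduced_cat a u b v :
  reduced (rcons u a) -> reduced (b :: v) -> b != flip a ->
  reduced (rcons u a ++ b :: v).
Proof.
rewrite /reduced => ru rv ab; case: u ru => [|c u] /=; first by rewrite ab.
by rewrite cat_path last_rcons /= ab /= => ->.
Qed.

Lemma reduced_catr u v : reduced (u ++ v) -> reduced v.
Proof.
rewrite /reduced; case: u => [|a u] //=.
by rewrite cat_path => /andP[_ /path_sorted].
Qed.

Lemma reduced_catl u v : reduced (u ++ v) -> reduced u.
Proof. by rewrite /reduced; case: u => [|a u] //=; rewrite cat_path => /andP[]. Qed.

Record reduced_word := ReducedWord { rw_seq :> seq letter; _ : reduced rw_seq }.
HB.instance Definition _ := [isSub for rw_seq].

Lemma rw_reduced (w : reduced_word) : reduced w.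
Proof. exact: (valP w). Qed.

Definition push_rw a (w : reduced_word) : reduced_word :=
  ReducedWord (reduced_push a (rw_reduced w)).

Lemma push_rwK a : cancel (push_rw a) (push_rw (flip a)).
Proof. by move=> w; apply: val_inj; rewrite /= pushK ?rw_reduced. Qed.

Lemma push_rwVK a : cancel (push_rw (flip a)) (push_rw a).
Proof. by move=> w; rewrite -{1}[a]flipK push_rwK. Qed.

Definition push_bij a := Bijection (push_rwK a) (push_rwVK a).

Hypothesis freeB : free_basis B.

(** A homomorphism from [F] to the subgroup of values of words that fixes the
    basis is, by uniqueness of extensions, the identity of [F]. *)
Lemma word_surj x : exists w, x = word w.
Proof.
pose S := [pred x : F | `[< exists w, x = word w >]].
have SP y : reflect (exists w, y = word w) (y \in S) by exact: asboolP.
have closS : group_closed S.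
  split; first by apply/SP; exists [::].
  move=> _ _ /SP[u ->] /SP[v ->]; apply/SP; exists (u ++ wordV v).
  by rewrite word_cat word_wordV.
pose K0 := {x : F | x \in S}.
pose K1 : groupType := HB.pack K0 (SubChoice_isSubGroup.Build F S K0 closS).
have SB (b : B) : \val b \in S.
  by apply/SP; exists [:: (b, true)]; rewrite /= mulg1.
have [phi [phiB _]] := freeB (K := K1) (fun b => exist _ (\val b) (SB b)).
have [psi [_ uniq_psi]] := freeB (K := F) (fun b => \val b).
pose toF (y : K1) : F := \val (y : K0).
have toFM : {morph (toF \o phi) : y z / y * z}.
  by move=> y z; rewrite /= gmulfM.
pose chi : {multiplicative F -> F} :=
  HB.pack (toF \o phi) (isMultiplicative.Build F F (toF \o phi) toFM).
have -> : x = chi x.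
  rewrite (uniq_psi chi); last by move=> b; rewrite /= /toF phiB.
  by rewrite -(uniq_psi [the {multiplicative F -> F} of idfun]).
by apply/SP; exact: (valP (phi x : K0)).
Qed.

Lemma gmulf1_group (K : groupType) (f : {multiplicative F -> K}) : f 1 = 1.
Proof. by apply: (mulgI (f 1)); rewrite -gmulfM !mulg1. Qed.

Lemma free_action : exists phi : {multiplicative F -> bijection reduced_word},
  forall a, phi (letter_val a) = push_bij a.
Proof.
have [phi [phiB _]] := freeB (fun b => push_bij (b, true)).
exists phi => -[b []]; rewrite /letter_val /=; first exact: phiB.
apply: (mulgI (phi (\val b))); rewrite -gmulfM mulgV gmulf1_group phiB.
by apply: bijection_ext => w /=; rewrite (push_rwVK (b, true)).
Qed.

(** Letters act on reduced words by multiplication and free cancellation. By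
    freeness this is an action of [F]; the orbit map of the empty word is then
    the reduced form. *)
Lemma reduced_form : exists nf : F -> seq letter,
  [/\ forall x, reduced (nf x), forall x, word (nf x) = x &
      forall w, reduced w -> nf (word w) = w].
Proof.
have [phi phiE] := free_action.
have phi1 := gmulf1_group phi.
pose e := @ReducedWord [::] isT.
exists (fun x => phi x e); split=> [x|x|w].
- exact: rw_reduced.
- have [w ->] := word_surj x; elim: w => [|a w IH] /=; first by rewrite phi1.
  by rewrite gmulfM /= phiE /= word_push IH.
- elim: w => [|a w IH] raw /=; first by rewrite phi1.
  by rewrite gmulfM /= phiE /= (IH (path_sorted raw)) push_reduced.
Qed.

End FreeGroupWords.

(** * The Cayley tree *)

Definition between (T : Type) (d : T -> T -> nat) (u x y : T) : Prop :=
  d x u + d u y = d x y.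

(** The vertex set of a tree on which [F] acts simply transitively. The axiom
    [tree_split] says that geodesic triangles are tripods and excludes cycles;
    [tree_free] gives elements other than [1] unbounded powers. *)
Record tree_metric (F : groupType) (d : F -> F -> nat) : Prop := TreeMetric {
  distxx : forall x, d x x = 0;
  dist_eq0 : forall x y, d x y = 0 -> x = y;
  dist_sym : forall x y, d x y = d y x;
  dist_triangle : forall x y z, d x z <= d x y + d y z;
  distM : forall g x y, d (g * x) (g * y) = d x y;
  tree_split : forall u x y z,
    between d u x y -> between d u x z \/ between d u z y;
  tree_median : forall x y z,
    exists m, [/\ between d m x y, between d m y z & between d m x z];
  tree_step : forall x y n, d x y = n.+1 -> exists z, d x z = n /\ d z y = 1%N;
  tree_free : forall g, g <> 1 -> d 1 g < d 1 (g * g) }.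

Section CommonPrefix.
Variable T : eqType.
Implicit Types u v w : seq T.

Fixpoint lcp u v : nat :=
  if u is a :: u' then
    if v is b :: v' then if a == b then (lcp u' v').+1 else 0 else 0
  else 0.

Lemma lcpC u v : lcp u v = lcp v u.
Proof.
elim: u v => [|a u IH] [|b v] //=; rewrite eq_sym; case: ifP => // _.
by rewrite IH.
Qed.

Lemma lcp_sizel u v : lcp u v <= size u.
Proof. by elim: u v => [|a u IH] [|b v] //=; case: ifP => // _; exact: IH. Qed.

Lemma lcp_sizer u v : lcp u v <= size v.
Proof. by rewrite lcpC lcp_sizel. Qed.

Lemma lcp_ultra u v w : minn (lcp u v) (lcp v w) <= lcp u w.
Proof.
elim: u v w => [|a u IH] [|b v] [|c w] //=; rewrite ?minn0 ?min0n //.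
have [<-|ab] := eqVneq a b; last by rewrite min0n.
by case: (a == c); rewrite ?minn0 // minnSS ltnS IH.
Qed.

Lemma lcp_takel k u v : lcp (take k u) v = minn k (lcp u v).
Proof.
elim: u v k => [|a u IH] [|b v] [|k] //=; rewrite ?minn0 ?min0n //.
by case: ifP => _; rewrite ?minn0 // IH minnSS.
Qed.

Lemma lcp_self u : lcp u u = size u.
Proof. by elim: u => //= a u ->; rewrite eqxx. Qed.

Lemma lcp_nth x0 u v i : i < lcp u v -> nth x0 u i = nth x0 v i.
Proof.
elim: u v i => [|a u IH] [|b v] [|i] //=; case: eqP => // _.
by rewrite ltnS; exact: IH.
Qed.

(** The four-point inequality of a tree, written with Gromov products. *)
Lemma lcp_four_point x y u z :
  minn (lcp x u + lcp y z) (lcp x z + lcp y u) <= lcp x y + lcp u z.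
Proof.
have := lcp_ultra x u y; have := lcp_ultra x z y.
have := lcp_ultra u x z; have := lcp_ultra u y z.
rewrite ?(lcpC u x) ?(lcpC u y) ?(lcpC z y); lia.
Qed.

Lemma lcp_prefix u v : lcp u v = size u -> u = take (size u) v.
Proof.
elim: u v => [|a u IH] [|b v] //=; case: eqP => // -> [/IH {1}->]; by [].
Qed.

Lemma lcp_split u v : exists p s t,
  [/\ u = p ++ s, v = p ++ t, size p = lcp u v &
      [\/ s = [::], t = [::] |
       exists a b s' t', [/\ s = a :: s', t = b :: t' & a != b]]].
Proof.
elim: u v => [|a u IH] v.
  by exists [::], [::], v; split=> //; apply: Or31.
case: v => [|b v]; first by exists [::], (a :: u), [::]; split=> //; apply: Or32.
rewrite /=; case: eqP => [<-|/eqP ab].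
  have [p [s [t [-> -> <- st]]]] := IH v.
  by exists (a :: p), s, t.
exists [::], (a :: u), (b :: v); split=> //; apply: Or33.
by exists a, b, u, v.
Qed.

End CommonPrefix.

Section CayleyTree.
Variables (F : groupType) (B : set F) (nf : F -> seq (letter B)).
Hypothesis nf_reduced : forall x, reduced (nf x).
Hypothesis nfK : forall x, word (nf x) = x.
Hypothesis wordK : forall w, reduced w -> nf (word w) = w.

Definition wlen (x : F) : nat := size (nf x).
Definition wdist (x y : F) : nat := wlen (x^-1 * y).

Lemma nfV x : nf x^-1 = wordV (nf x).
Proof. by rewrite -{1}[x]nfK -word_wordV wordK // reduced_wordV. Qed.

Lemma nf1 : nf 1 = [::].
Proof. exact: (@wordK [::]). Qed.

Lemma wlen_take k x : k <= wlen x -> wlen (word (take k (nf x))) = k.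
Proof.
move=> kx; rewrite /wlen wordK ?size_takel //.
by apply: (@reduced_catl _ _ _ (drop k (nf x))); rewrite cat_take_drop.
Qed.

Lemma nf_take k x : nf (word (take k (nf x))) = take k (nf x).
Proof.
by rewrite wordK //; apply: (@reduced_catl _ _ _ (drop k (nf x)));
  rewrite cat_take_drop.
Qed.

(** Cancellation in [x^-1 * y] removes the longest common prefix, and nothing
    more. *)
Lemma nf_mulV x y : exists p s t,
  [/\ nf x = p ++ s, nf y = p ++ t, size p = lcp (nf x) (nf y) &
      nf (x^-1 * y) = wordV s ++ t].
Proof.
have [p [s [t [xE yE pE st]]]] := lcp_split (nf x) (nf y).
exists p, s, t; split=> //.
have -> : x^-1 * y = word (wordV s ++ t).
  rewrite -[x]nfK -[y]nfK xE yE !word_cat word_wordV invgM.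
  by rewrite -mulgA mulKg.
have rs : reduced s by apply: (@reduced_catr _ _ p); rewrite -xE.
have rt : reduced t by apply: (@reduced_catr _ _ p); rewrite -yE.
apply: wordK.
case: st => [->|->|[a [b [s' [t' [sE tE ab]]]]]].
- exact: rt.
- by rewrite cats0 reduced_wordV.
- have sE' : wordV s = rcons (wordV s') (flip a).
    by rewrite sE /wordV /= rev_cons.
  rewrite sE' tE; apply: reduced_cat; rewrite -?tE ?flipK 1?eq_sym //.
  by rewrite -sE' reduced_wordV.
Qed.

(** The length of the common prefix is the Gromov product based at [1]; every
    metric property of the tree is read off from this identity. *)
Lemma wdist_lcp x y :
  wdist x y + (lcp (nf x) (nf y)).*2 = wlen x + wlen y.
Proof.
have [p [s [t [xE yE <- xyE]]]] := nf_mulV x y.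
rewrite /wdist /wlen xyE xE yE !size_cat.
by rewrite /wordV size_rev size_map -addnn [RHS]addnACA addnC.
Qed.

Lemma wdist1 x : wdist 1 x = wlen x.
Proof. by rewrite /wdist invg1 mul1g. Qed.

Lemma wdistM g x y : wdist (g * x) (g * y) = wdist x y.
Proof. by rewrite /wdist invgM -mulgA mulKg. Qed.

Lemma wdist_sym x y : wdist x y = wdist y x.
Proof. by have := wdist_lcp x y; have := wdist_lcp y x; rewrite lcpC; lia. Qed.

Lemma wdist_triangle x y z : wdist x z <= wdist x y + wdist y z.
Proof.
have := wdist_lcp x y; have := wdist_lcp y z.
have := wdist_lcp x z; have := lcp_ultra (nf x) (nf y) (nf z).
have := lcp_sizer (nf x) (nf y); have := lcp_sizel (nf y) (nf z).
rewrite -/(wlen y); lia.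
Qed.

Lemma wdist_take k x y : k <= wdist x y ->
  wdist x (x * word (take k (nf (x^-1 * y)))) = k /\
  wdist (x * word (take k (nf (x^-1 * y)))) y = wdist x y - k.
Proof.
move=> kxy; rewrite -{1}[x]mulg1 wdistM wdist1 wlen_take //; split=> //.
rewrite -{2}[y](mulVKg x) wdistM.
have := wdist_lcp (word (take k (nf (x^-1 * y)))) (x^-1 * y).
rewrite nf_take lcp_takel lcp_self wlen_take // (minn_idPl kxy).
rewrite -/(wdist x y); set D := wdist (word _) _; lia.
Qed.

(** The common prefix of an element and its inverse is shorter than half of it: a
    longer one would make some letter of the reduced word equal to its own
    inverse, or adjacent to it. *)
Lemma wlen_square g : g <> 1 -> wlen g < wlen (g * g).
Proof.
move=> g1; rewrite -{2}[g]invgK -/(wdist g^-1 g).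
have := wdist_lcp g^-1 g; have -> : wlen g^-1 = wlen g.
  by rewrite /wlen nfV /wordV size_rev size_map.
rewrite nfV.
suff: (lcp (wordV (nf g)) (nf g)).*2 < wlen g by lia.
rewrite ltnNge; apply/negP; set c := lcp _ _ => cg.
have g0 : 0 < wlen g.
  rewrite lt0n; apply/eqP => /size0nil g0.
  by apply: g1; rewrite -[g]nfK g0.
have [x0 _] : exists x0 : letter B, True.
  by move: g0; rewrite /wlen; case: (nf g) => // a; exists a.
have nthV i : i < c ->
    nth x0 (nf g) i = flip (nth x0 (nf g) (wlen g - i.+1)).
  move=> ic; rewrite -(lcp_nth x0 ic) /wordV nth_rev size_map; last first.
    by apply: leq_trans ic _; exact: lcp_sizer.
  by rewrite (nth_map x0) -/(wlen g) //; lia.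
have cn : c <= wlen g by exact: lcp_sizer.
have [ev|od] := boolP (odd (wlen g)).
  have hc : (wlen g)./2 < c by lia.
  have := nthV _ hc; rewrite (_ : wlen g - _ = (wlen g)./2); last by lia.
  by move/esym/eqP; rewrite flip_neq.
have hc : (wlen g)./2.-1 < c by lia.
have hg : (wlen g)./2.-1.+1 < size (nf g) by rewrite -/(wlen g); lia.
have /negP[] := sortedP x0 (nf_reduced g) _ hg.
by rewrite (nthV _ hc) flipK; apply/eqP; congr nth; lia.
Qed.

Lemma wdist_tree : tree_metric wdist.
Proof.
split.
- by move=> x; rewrite /wdist mulVg /wlen nf1.
- move=> x y /size0nil xy0; apply: (mulgI x^-1).
  by rewrite mulVg -[RHS]nfK xy0.
- exact: wdist_sym.
- exact: wdist_triangle.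
- exact: wdistM.
- move=> u x y z; rewrite /between.
  have xu := wdist_lcp x u; have uy := wdist_lcp u y; have xy := wdist_lcp x y.
  have uz := wdist_lcp u z; have xz := wdist_lcp x z; have zu := wdist_lcp z u.
  have zy := wdist_lcp z y.
  have := lcp_four_point (nf x) (nf y) (nf u) (nf z).
  have := wdist_triangle x u z; have := wdist_triangle z u y.
  move: xu uy xy uz xz zu zy.
  rewrite (lcpC (nf u) (nf y)) (lcpC (nf z) (nf y)) (lcpC (nf z) (nf u)).
  lia.
- move=> x y z; pose a := x^-1 * y; pose b := x^-1 * z.
  pose k := lcp (nf a) (nf b); exists (x * word (take k (nf a))).
  have ka : k <= wlen a by exact: lcp_sizel.
  have [xm my] := wdist_take (ka : k <= wdist x y).
  have mz : wdist (x * word (take k (nf a))) z = wlen b - k.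
    rewrite -[z](mulVKg x) wdistM -/b.
    have := wdist_lcp (word (take k (nf a))) b.
    rewrite nf_take lcp_takel minnn wlen_take //; lia.
  have kb : k <= wlen b by exact: lcp_sizer.
  have yz : wdist y z + k.*2 = wlen a + wlen b.
    by rewrite -wdist_lcp -[y](mulVKg x) -[z](mulVKg x) wdistM.
  rewrite /between (wdist_sym y) xm my mz.
  rewrite -[wdist x y]/(wlen a) -[wdist x z]/(wlen b); split; lia.
- move=> x y n xy; have nxy : n <= wdist x y by lia.
  have [xz zy] := wdist_take nxy; eexists; split; first exact: xz.
  by rewrite zy; lia.
- by move=> g g1; rewrite !wdist1 wlen_square.
Qed.

Lemma between_prefix u x :
  between wdist u 1 x -> u = word (take (wlen u) (nf x)).
Proof.
rewrite /between !wdist1 => uux; rewrite -{1}[u]nfK; congr word.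
apply: lcp_prefix; have := wdist_lcp u x; rewrite -/(wlen u); lia.
Qed.

Lemma mem_nfM x y a : a \in nf (x * y) -> (a \in nf x) || (a \in nf y).
Proof.
have [p [s [t [xE yE _ xyE]]]] := nf_mulV x^-1 y.
rewrite invgK in xyE; rewrite xyE -[x]invgK nfV xE yE !mem_cat /wordV.
by rewrite map_cat rev_cat mem_cat; case/orP => ->; rewrite ?orbT.
Qed.

Lemma mem_nfV x a : (a \in nf x^-1) = (flip a \in nf x).
Proof. by rewrite nfV /wordV mem_rev -{1}[a]flipK (mem_map (inv_inj (@flipK F B))). Qed.

End CayleyTree.

(** * Convex sets and projections in a tree *)

Section TreeGeometry.
Variables (F : groupType) (d : F -> F -> nat).
Hypothesis tree : tree_metric d.

Implicit Types (x y z u p q : F) (C : set F).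

Definition convex C : Prop :=
  forall x y u, C x -> C y -> between d u x y -> C u.

(** The gate of [x] in [C] is its nearest-point projection. *)
Definition gate C x p : Prop := C p /\ forall y, C y -> between d p x y.

Lemma between_sym u x y : between d u x y -> between d u y x.
Proof.
by rewrite /between (dist_sym tree y u) (dist_sym tree u x) (dist_sym tree y x) addnC.
Qed.

Lemma between_trans p q x y :
  between d p x y -> between d q x p -> between d p q y /\ between d q x y.
Proof.
rewrite /between => pxy qxp.
have := dist_triangle tree x q y; have := dist_triangle tree q p y; lia.
Qed.

Lemma between_antisym p q x :
  between d p x q -> between d q x p -> p = q.
Proof.
rewrite /between (dist_sym tree q p) => pxq qxp; apply: (dist_eq0 tree); lia.
Qed.

Lemma betweenM g u x y :
  between d (g * u) (g * x) (g * y) <-> between d u x y.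
Proof. by rewrite /between !(distM tree). Qed.

(** A nearest point [c] of [C] is a gate: for [y] in [C], the median of [x], [c]
    and [y] lies in [C] and is no farther from [x] than [c]. *)
Lemma gate_exists C x c : convex C -> C c -> exists p, gate C x p.
Proof.
move=> cvxC; have [n] := ubnP (d x c); elim: n c => // n IH c; rewrite ltnS => xc Cc.
have [all_btw|] := pselect (forall y, C y -> between d c x y).
  by exists c.
move/existsNP => [y /not_implyP[Cy not_btw]].
have [m [xm my xcm]] := tree_median tree x c y.
have Cm : C m by apply: cvxC my.
apply: (IH m) => //; apply: leq_trans xc; rewrite ltnNge; apply/negP => cm.
apply: not_btw; suff -> : c = m by [].
apply: (dist_eq0 tree); rewrite (dist_sym tree).
by move: xm; rewrite /between; lia.
Qed.

(** Where medians alone would allow a square, two points with distinct gates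
    can only be joined through both gates. *)
Lemma gate_between C x y p q : gate C x p -> gate C y q -> p <> q ->
  between d p x y /\ between d q x y.
Proof.
have half x' y' p' q' : gate C x' p' -> gate C y' q' -> p' <> q' -> between d p' x' y'.
  move=> [Cp xp] [Cq yq] pq; have [//|pqy] := tree_split tree y' (xp _ Cq).
  by case: pq; apply: (@between_antisym _ _ y'); [exact: pqy|exact: yq].
move=> xp yq pq; split; first exact: half xp yq pq.
by apply/between_sym/(half _ _ _ _ yq xp)/nesym.
Qed.

Lemma gate_dist C x y p q : gate C x p -> gate C y q -> p <> q ->
  d x y = d x p + d p q + d q y.
Proof.
move=> xp yq pq; have [pxy _] := gate_between xp yq pq.
have := (yq.2 _ xp.1); move: pxy; rewrite /between.
rewrite (dist_sym tree y q) (dist_sym tree q p) (dist_sym tree y p); lia.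
Qed.

Lemma gate_in C D x c p : convex D -> D x -> D c -> C c -> gate C x p -> D p.
Proof. by move=> cvxD Dx Dc Cc [_ xp]; apply: cvxD (xp _ Cc). Qed.

Lemma dist1M x g : d x (g * x) = d 1 (g ^ x).
Proof. by rewrite -[RHS](distM tree x) mulg1 conjgE mulVKg. Qed.

(** Squaring strictly increases the displacement of [1]. *)
Lemma dist_expg_unbounded g n : g <> 1 -> exists m, n <= d 1 (g ^+ m).
Proof.
move=> g1; suff [m [_ nm]] : exists m, g ^+ m <> 1 /\ n <= d 1 (g ^+ m) by exists m.
elim: n => [|n [m [gm1 nm]]]; first by exists 1%N.
have lt_mm := tree_free tree gm1.
exists (m + m)%N; rewrite expgnDr; split; last exact: leq_ltn_trans lt_mm.
by move=> gmm; rewrite gmm (distxx tree) in lt_mm.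
Qed.

Definition nbhd C x : Prop := exists c, C c /\ d c x <= 1.

Lemma sub_nbhd C : C `<=` nbhd C.
Proof. by move=> x Cx; exists x; rewrite (distxx tree). Qed.

Lemma nbhd_convex C : convex C -> convex (nbhd C).
Proof.
move=> cvxC x y u [a [Ca ax]] [b [Cb bxy]] uxy.
have small c z : C c -> d c z <= 1 -> between d u c z -> nbhd C u.
  by move=> Cc cz; rewrite /between => czu; exists c; split=> //; lia.
have [/between_sym|] := tree_split tree a uxy; first exact: small.
move=> /(tree_split tree b)[uab|]; last exact: small.
by apply: sub_nbhd; apply: cvxC uab.
Qed.

Lemma geodesic_point x y k : k <= d x y -> exists z, d x z = k /\ between d z x y.
Proof.
have [n kn] := ubnP (d x y - k); elim: n k kn => // n IH k kn kxy.
have [->|kne] := eqVneq k (d x y).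
  by exists y; rewrite /between (distxx tree) addn0.
have [||z [xz zxy]] := IH k.+1; [by lia|by lia|].
have [w [xw wz]] := tree_step tree xz; exists w; split=> //.
move: zxy; rewrite /between xz xw.
have := dist_triangle tree w z y; have := dist_triangle tree x w y; rewrite wz xw; lia.
Qed.

End TreeGeometry.

(** Subtrees of the tree, permuted by [F], each with a group [N i] of rotations
    that stabilizes it. Small cancellation is the contrast between the bound [L]
    on overlaps and the displacement of the rotations; [5 * L + 2] is what
    [near_rotate] consumes. *)
Record tree_family (F : groupType) (d : F -> F -> nat) (L : nat) (I : Type)
    (act : F -> I -> I) (Y N : I -> set F) : Prop := TreeFamily {
  act1 : forall i, act 1 i = i;
  actM : forall g h i, act (g * h) i = act g (act h i);
  fam_convex : forall i, convex d (Y i);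
  fam_nonempty : forall i, exists x, Y i x;
  fam_act : forall g i x, Y i x -> Y (act g i) (g * x);
  fam_overlap : forall i j x y,
    i <> j -> Y i x -> Y i y -> Y j x -> Y j y -> d x y <= L;
  rot_group : forall i, is_subgroup (N i);
  rot_act : forall g i n, N i n -> N (act g i) (n ^ g^-1);
  rot_stab : forall i n, N i n -> act n i = i;
  rot_far : forall i n x, N i n -> n <> 1 -> Y i x -> 5 * L + 2 < d x (n * x) }.

(** * Windmills *)

Section Windmill.
Variables (F : groupType) (d : F -> F -> nat).
Hypothesis tree : tree_metric d.
Variables (L : nat) (I : Type) (act : F -> I -> I) (Y N : I -> set F).
Hypothesis fam : tree_family d L act Y N.

(** The last property is the one to be propagated: the elements of [G] that
    stabilize a subtree of the windmill are the rotations of that subtree. *)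
Record windmill (W G : set F) (A : set I) : Prop := Windmill {
  wm_convex : convex d W;
  wm_one : W 1;
  wm_group : is_subgroup G;
  wm_tree_act : forall g x, G g -> W x -> W (g * x);
  wm_index_act : forall g i, G g -> A i -> A (act g i);
  wm_fam_sub : forall i, A i -> Y i `<=` W;
  wm_rot_sub : forall i, A i -> N i `<=` G;
  wm_thin : forall i x y, ~ A i -> W x -> W y -> Y i x -> Y i y -> d x y <= 2 * L;
  wm_faithful : forall i g, A i -> G g -> act g i = i -> N i g }.

Definition frontier (W : set F) (A : set I) : set I :=
  fun i => ~ A i /\ exists x, nbhd d W x /\ Y i x.

(** Reduced products of nontrivial rotations about subtrees of [R], consecutive
    ones about different subtrees; the option is the subtree of the leftmost
    factor. *)
Inductive syllables (R : set I) : option I -> F -> Prop :=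
| syl_nil : syllables R None 1
| syl_cons i n o k : R i -> N i n -> n <> 1 -> syllables R o k -> o <> Some i ->
    syllables R (Some i) (n * k).

(** The group generated by [G] and the rotations about the frontier. Since [G]
    permutes the frontier, elements of [G] can be moved to the right end of a
    product, which leaves one reduced product followed by an element of [G]. *)
Definition next_group (W G : set F) (A : set I) : set F :=
  fun x => exists o k g, [/\ syllables (frontier W A) o k, G g & x = k * g].

Definition thickening (W : set F) (A : set I) : set F :=
  fun x => nbhd d W x \/ exists i, frontier W A i /\ Y i x.

Definition next_tree (W G : set F) (A : set I) : set F :=
  fun x => exists g v, [/\ next_group W G A g, thickening W A v & x = g * v].

Definition next_index (W G : set F) (A : set I) : set I :=
  fun i => exists g j, [/\ next_group W G A g, A j \/ frontier W A j & i = act g j].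

Lemma actK g i : act g^-1 (act g i) = i.
Proof. by rewrite -(actM fam) mulVg (act1 fam). Qed.

Lemma actVK g i : act g (act g^-1 i) = i.
Proof. by rewrite -(actM fam) mulgV (act1 fam). Qed.

Lemma fam_actV g i x : Y (act g i) x -> Y i (g^-1 * x).
Proof. by move/(fam_act fam g^-1); rewrite actK. Qed.

Lemma gate_act g i x p : gate d (Y i) x p -> gate d (Y (act g i)) (g * x) (g * p).
Proof.
move=> [Yp xp]; split; first exact: fam_act fam _ _ _ Yp.
by move=> y /fam_actV Yy; rewrite -[y](mulVKg g) betweenM //; exact: xp.
Qed.

Section Step.
Variables (W G : set F) (A : set I).
Hypothesis wm : windmill W G A.

Local Notation R := (frontier W A).
Local Notation V := (thickening W A).
Local Notation G' := (next_group W G A).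
Local Notation W' := (next_tree W G A).
Local Notation A' := (next_index W G A).

Lemma wm_group1 : G 1. Proof. by case: (wm_group wm). Qed.
Lemma wm_groupM x y : G x -> G y -> G (x * y).
Proof. by case: (wm_group wm) => _ h _; exact: h. Qed.
Lemma wm_groupV x : G x -> G x^-1.
Proof. by case: (wm_group wm) => _ _ h; exact: h. Qed.

Lemma nbhd_act g x : G g -> nbhd d W x -> nbhd d W (g * x).
Proof.
move=> Gg [w [Ww wx]]; exists (g * w); rewrite (distM tree).
by split=> //; exact: wm_tree_act wm _ _ Gg Ww.
Qed.

Lemma index_actE g i : G g -> A (act g i) -> A i.
Proof. by move=> /wm_groupV Gg /(wm_index_act wm Gg); rewrite actK. Qed.

Lemma frontier_act g i : G g -> R i -> R (act g i).
Proof.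
move=> Gg [nAi [x [Wx Yx]]]; split; first by move/(index_actE Gg).
exists (g * x); split; first exact: nbhd_act.
exact: fam_act fam _ _ _ Yx.
Qed.

Lemma thickening_act g x : G g -> V x -> V (g * x).
Proof.
move=> Gg [Wx|[i [Ri Yx]]]; first by left; exact: nbhd_act.
right; exists (act g i); split; first exact: frontier_act.
exact: fam_act fam _ _ _ Yx.
Qed.

Lemma nbhdW_convex : convex d (nbhd d W).
Proof. exact (nbhd_convex tree (wm_convex wm)). Qed.

(** * Ping-pong on the projections to a frontier subtree *)

Definition overlap i : set F := fun x => nbhd d W x /\ Y i x.

(** The thresholds [L] and [2 * L] keep the projections of a near point and of a
    far point more than [L] apart. *)
Definition near i x : Prop :=
  exists p o, [/\ gate d (Y i) x p, overlap i o & d o p <= L].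

Definition far i x : Prop :=
  exists p, gate d (Y i) x p /\ forall o, overlap i o -> 2 * L < d o p.

(** [W] itself meets a frontier subtree in at most [2 * L], and the neighborhood
    adds at most one edge at each end. *)
Lemma overlap_diam i x y : R i -> overlap i x -> overlap i y -> d x y <= 2 * L + 2.
Proof.
move=> [nAi _] [[a [Wa ax]] Yx] [[b [Wb bxy]] Yy].
have [p [Wp xp]] := gate_exists tree x (wm_convex wm) Wa.
have [q [Wq yq]] := gate_exists tree y (wm_convex wm) Wb.
have pa := xp _ Wa; have qb := yq _ Wb.
have [pq|pq] := pselect (p = q).
  have := dist_triangle tree x p y; move: pa qb; rewrite /between pq.
  rewrite (dist_sym tree y q) (dist_sym tree y b) (dist_sym tree x a); lia.
have [pxy qxy] := gate_between tree (conj Wp xp) (conj Wq yq) pq.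
have := wm_thin wm nAi Wp Wq (fam_convex fam Yx Yy pxy) (fam_convex fam Yx Yy qxy).
have := gate_dist tree (conj Wp xp) (conj Wq yq) pq.
move: pa qb; rewrite /between (dist_sym tree y q) (dist_sym tree y b) (dist_sym tree x a); lia.
Qed.

Lemma overlap_gate i x p : R i -> nbhd d W x -> gate d (Y i) x p -> overlap i p.
Proof.
move=> [_ [o [Wo Yo]]] Wx xp; split; last exact: xp.1.
exact: gate_in nbhdW_convex Wx Wo Yo xp.
Qed.

Lemma fam_gate i x : exists p, gate d (Y i) x p.
Proof.
have [c Yc] := fam_nonempty fam i.
exact (gate_exists tree x (fam_convex fam (i := i)) Yc).
Qed.

Lemma nbhd_near i x : R i -> nbhd d W x -> near i x.
Proof.
move=> Ri Wx; have [p xp] := fam_gate i x; exists p, p; split=> //.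
  exact: overlap_gate xp.
by rewrite (distxx tree).
Qed.

Lemma nbhd_not_far i x : R i -> nbhd d W x -> ~ far i x.
Proof.
move=> Ri Wx [p [xp farp]]; have := farp p (overlap_gate Ri Wx xp).
by rewrite (distxx tree); lia.
Qed.

(** Otherwise a path from the projection of [x] to its rotated image, through
    two points of the overlap, would have length at most
    [L + (2 * L + 2) + 2 * L]. *)
Lemma near_rotate i n x : R i -> N i n -> n <> 1 -> near i x -> far i (n * x).
Proof.
move=> Ri Nn n1 [p [o [xp Oo op]]]; exists (n * p); split.
  by rewrite -{1}(rot_stab fam Nn); exact: gate_act.
move=> o' Oo'; rewrite ltnNge; apply/negP => o'np.
have := rot_far fam Nn n1 xp.1; have := overlap_diam Ri Oo Oo'.
have := dist_triangle tree p o (n * p); have := dist_triangle tree o o' (n * p).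
rewrite (dist_sym tree p o); lia.
Qed.

(** The projections to [Y i] of [x] and of a point [oj] of the overlap of [Y j],
    when different, lie on the geodesic between these two points, which lies
    in [Y j]; so they are both in [Y i] and in [Y j]. *)
Lemma fam_near i j x : R i -> R j -> i <> j -> Y j x -> near i x.
Proof.
move=> Ri Rj ij Yx; have [oj [Woj Yoj]] := Rj.2.
have [o ojo] := fam_gate i oj; have Oo := overlap_gate Ri Woj ojo.
have [q xq] := fam_gate i x; exists q, o; split=> //.
have [->|qo] := pselect (q = o); first by rewrite (distxx tree).
have [bq bo] := gate_between tree xq ojo qo.
apply: (fam_overlap fam ij) Oo.2 xq.1 _ _.
- exact: fam_convex fam _ _ _ _ Yx Yoj bo.
- exact: fam_convex fam _ _ _ _ Yx Yoj bq.
Qed.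

(** With [oj] in the overlap of [Y j], let [o] and [q] be the projections to
    [Y i] of [oj] and [x], and let [p] be the projection of [x] to [Y j]. All
    three lie on the geodesic from [x] to [oj], unless [q = o]. If [p] precedes
    [q] and [o], these are in [Y j], and the overlap bound applies. Otherwise
    [p] would be close to the overlap of [Y j]: if it follows [q] and [o], it is
    in the neighborhood of [W]; if it is between them, it is in [Y i], hence
    within [L] of [o], which is then in the overlap of [Y j]. *)
Lemma far_near i j x : R i -> R j -> i <> j -> far j x -> near i x.
Proof.
move=> Ri Rj ij [p [xp farp]]; have [oj [Woj Yoj]] := Rj.2.
have [o ojo] := fam_gate i oj; have Oo := overlap_gate Ri Woj ojo.
have [q xq] := fam_gate i x; exists q, o; split=> //.
have [->|qo] := pselect (q = o); first by rewrite (distxx tree).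
have [bq bo] := gate_between tree xq ojo qo.
have bp := xp.2 _ Yoj.
have cvxi := fam_convex fam (i := i); have cvxj := fam_convex fam (i := j).
have qo_between : between d o q oj.
  by apply: (between_sym tree); exact: ojo.2 _ xq.1.
case: (tree_split tree p bq) => [qxp|qpo]; last first.
  have Yjq : Y j q by exact: cvxj xp.1 Yoj qpo.
  exact: (fam_overlap fam ij) Oo.2 xq.1 (cvxj _ _ _ Yjq Yoj qo_between) Yjq.
case: (tree_split tree p bo) => [oxp|opo].
  have [po _] := between_trans tree bp oxp.
  have Op : overlap j p by split; [exact: nbhdW_convex Oo.1 Woj po|exact: xp.1].
  by have := farp p Op; rewrite (distxx tree); lia.
have Yjo : Y j o by exact: cvxj xp.1 Yoj opo.
have pqo : between d p q o.
  have [pqoj _] := between_trans tree bp qxp.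
  by move: pqoj opo qo_between; rewrite /between; lia.
have Yip : Y i p by exact: cvxi xq.1 Oo.2 pqo.
have := farp o (conj Oo.1 Yjo).
have := fam_overlap fam ij Oo.2 Yip Yjo xp.1; lia.
Qed.

Lemma syllables_frontier i k : syllables R (Some i) k -> R i.
Proof. by inversion 1. Qed.

(** Ping-pong: a far point for one frontier subtree is near for any other one,
    and a nontrivial rotation makes it far again. *)
Lemma pong_nbhd o k i b : syllables R o k -> o = Some i -> nbhd d W b -> far i (k * b).
Proof.
move=> sk oi Wb; elim: sk i oi => // {o k} i n o k Ri Nn n1 sk IH oi _ [<-].
rewrite -mulgA; apply: near_rotate => //.
case: o sk IH oi => [j|] sk IH ij.
  apply: far_near (syllables_frontier sk) _ (IH _ erefl) => //.
  by move=> ji; apply: ij; rewrite ji.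
by inversion sk; rewrite mul1g; exact: nbhd_near.
Qed.

Lemma pong_fam o k i j : syllables R o k -> o = Some i -> R j ->
  (forall b, Y j b -> far i (k * b)) \/ (j = i /\ N i k).
Proof.
move=> sk oi Rj; elim: sk i oi => // {o k} i n o k Ri Nn n1 sk IH oi _ [<-].
case: o sk IH oi => [l|] sk IH il; last first.
  have k1 : k = 1 by inversion sk.
  have [<-|ij] := pselect (i = j); first by right; rewrite k1 mulg1.
  left=> b Yb; rewrite k1 mulg1; apply: near_rotate => //.
  exact: fam_near Yb.
have Rl := syllables_frontier sk.
have {}il : i <> l by move=> il'; apply: il; rewrite il'.
left=> b Yb; rewrite -mulgA; apply: near_rotate => //.
have [/(_ b Yb)|[jl Nk]] := IH _ erefl; first exact: far_near.
apply: (fam_near Ri Rl il); rewrite -(rot_stab fam Nk) -jl.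
exact: fam_act fam _ _ _ Yb.
Qed.

(** The second alternative accounts for the points of [Y i] that a rotation about
    [Y i] brings close to the overlap. *)
Lemma pong o k i b : syllables R o k -> o = Some i -> V b ->
  far i (k * b) \/ Y i (k * b).
Proof.
move=> sk oi [Wb|[j [Rj Yb]]]; first by left; exact: pong_nbhd sk oi Wb.
have [/(_ b Yb)|[ji Nk]] := pong_fam sk oi Rj; first by left.
by right; rewrite -(rot_stab fam Nk) -ji; exact: fam_act fam _ _ _ Yb.
Qed.


(** * The next windmill *)

Lemma syllables_conj o k g : syllables R o k -> G g ->
  syllables R (omap (act g) o) (k ^ g^-1).
Proof.
move=> sk Gg; elim: sk => {o k} [|i n o k Ri Nn n1 _ IH oi] /=.
  by rewrite conj1g; exact: syl_nil.
rewrite conjMg; apply: syl_cons IH _.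
- exact: frontier_act.
- exact: rot_act fam _ _ _ Nn.
- by move/eqP; rewrite conjg_eq1 => /eqP.
- case: o oi => //= j ji [] /(congr1 (act g^-1)); rewrite !actK => ji'.
  by apply: ji; rewrite ji'.
Qed.

Lemma next_groupG g : G g -> G' g.
Proof. by exists None, 1, g; rewrite mul1g; split=> //; exact: syl_nil. Qed.

Lemma next_group_mulG g x : G g -> G' x -> G' (g * x).
Proof.
move=> Gg [o [k [h [sk Gh ->]]]].
exists (omap (act g) o), (k ^ g^-1), (g * h); split.
- exact: syllables_conj.
- exact: wm_groupM.
- by rewrite conjgE invgK !mulgA mulgVK.
Qed.

Lemma next_group_mulN i n x : R i -> N i n -> G' x -> G' (n * x).
Proof.
move=> Ri Nn [o [k [g [sk Gg ->]]]].
have [->|n1] := pselect (n = 1); first by rewrite mul1g; exists o, k, g.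
have [oi|oi] := pselect (o = Some i); last first.
  by exists (Some i), (n * k), g; rewrite mulgA; split=> //; exact: syl_cons sk oi.
case: sk oi => // j n' o' k' Rj Nn' n'1 sk' o'j [ji].
move: Rj Nn' o'j; rewrite {}ji => Rj Nn' o'i.
have [nn'|nn'] := pselect (n * n' = 1).
  by exists o', k', g; rewrite !mulgA nn' mul1g.
exists (Some i), (n * n' * k'), g; rewrite !mulgA; split=> //.
apply: syl_cons sk' o'i => //.
by have [_ NM _] := rot_group fam i; exact: NM.
Qed.

Lemma next_group_subgroup : is_subgroup G'.
Proof.
have mul x y : G' x -> G' y -> G' (x * y).
  move=> [o [k [g [sk Gg ->]]]] G'y.
  elim: sk => {o k} [|i n o k Ri Nn n1 _ IH _].
    by rewrite mul1g; exact: next_group_mulG.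
  by rewrite -!(mulgA n); exact: next_group_mulN Ri Nn IH.
have one : G' 1 by exact/next_groupG/wm_group1.
split=> // _ [o [k [g [sk Gg ->]]]].
elim: sk => {o k} [|i n o k Ri Nn n1 _ IH _].
  by rewrite mul1g; exact/next_groupG/wm_groupV.
rewrite -mulgA invgM; apply: mul => //; rewrite -[n^-1]mulg1.
by apply: next_group_mulN Ri _ one; have [_ _] := rot_group fam i; apply.
Qed.

Lemma next_group1 : G' 1. Proof. by case: next_group_subgroup. Qed.
Lemma next_groupM x y : G' x -> G' y -> G' (x * y).
Proof. by case: next_group_subgroup => _ h _; exact: h. Qed.
Lemma next_groupV x : G' x -> G' x^-1.
Proof. by case: next_group_subgroup => _ _ h; exact: h. Qed.

Lemma next_group_rot i n : R i -> N i n -> G' n.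
Proof. by move=> Ri Nn; rewrite -[n]mulg1; exact (next_group_mulN Ri Nn next_group1). Qed.

Lemma thickening_next_tree : V `<=` W'.
Proof. by move=> x Vx; exists 1, x; rewrite mul1g; split=> //; exact: next_group1. Qed.

Lemma next_tree_act g x : G' g -> W' x -> W' (g * x).
Proof.
move=> G'g [h [v [G'h Vv ->]]]; exists (g * h), v; rewrite mulgA.
by split=> //; exact: next_groupM.
Qed.

Lemma next_index_act g i : G' g -> A' i -> A' (act g i).
Proof.
move=> G'g [h [j [G'h Aj ->]]]; exists (g * h), j; rewrite (actM fam).
by split=> //; exact: next_groupM.
Qed.

Lemma next_index_actV g i : G' g -> ~ A' i -> ~ A' (act g^-1 i).
Proof. by move=> G'g nA' /(next_index_act G'g); rewrite actVK. Qed.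

Lemma frontier_next i : R i -> A' i.
Proof.
move=> Ri; exists 1, i; rewrite (act1 fam); split; [exact: next_group1|by right|by []].
Qed.

Lemma index_next i : A i -> A' i.
Proof.
move=> Ai; exists 1, i; rewrite (act1 fam); split; [exact: next_group1|by left|by []].
Qed.

Lemma nbhd_index i x : nbhd d W x -> Y i x -> A' i.
Proof.
move=> Wx Yx; have [Ai|nAi] := pselect (A i); first exact: index_next.
by apply: frontier_next; split=> //; exists x.
Qed.

Lemma thickening_convex : convex d V.
Proof.
have root x : V x -> exists2 o, nbhd d W o & forall u, between d u x o -> V u.
  move=> [Wx|[i [Ri Yx]]].
    by exists x => // u ux; left; exact (nbhdW_convex Wx Wx ux).
  have [_ [o [Wo Yo]]] := Ri; exists o => // u ux.
  by right; exists i; split=> //; exact: fam_convex fam _ _ _ _ Yx Yo ux.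
move=> x y u /root[o Wo xo] /root[o' Wo' yo'] uxy.
case: (tree_split tree o uxy) => [/xo//|].
case/(tree_split tree o') => [uoo'|]; last by move/(between_sym tree)/yo'.
by left; exact: nbhdW_convex Wo Wo' uoo'.
Qed.

(** The geodesic from [a] to [n * (k * b)] is covered by geodesics that pass
    through a point [n * c] of the subtree fixed by the rotation [n]. *)
Lemma next_tree_segment o k a b u : syllables R o k -> V a -> V b ->
  between d u a (k * b) -> W' u.
Proof.
move=> sk; elim: sk a b u => {o k} [|i n o k Ri Nn n1 sk IH oi] a b u Va Vb.
  by rewrite mul1g => uab; apply: thickening_next_tree; exact: thickening_convex uab.
have [_ [c [Wc Yc]]] := Ri; rewrite -mulgA => /(tree_split tree (n * c))[uac|].
  apply: thickening_next_tree; apply: thickening_convex Va _ uac.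
  right; exists i; split=> //; rewrite -(rot_stab fam Nn).
  exact: fam_act fam _ _ _ Yc.
rewrite -[u](mulVKg n) betweenM // => ucb.
apply: next_tree_act; first exact: next_group_rot Ri Nn.
by apply: IH ucb => //; left.
Qed.

Lemma next_tree_convex : convex d W'.
Proof.
move=> _ _ u [g [a [G'g Va ->]]] [h [b [G'h Vb ->]]].
rewrite -[u](mulVKg g) -[h](mulVKg g) -mulgA betweenM // => uab.
apply: next_tree_act => //.
have [o [k [l [sk Gl ghE]]]] := next_groupM (next_groupV G'g) G'h.
move: uab; rewrite ghE -mulgA; apply: next_tree_segment sk Va _.
exact: thickening_act.
Qed.

(** A subtree that is not adjoined misses the neighborhood of [W], so its points
    [a] and [b] in the thickening lie in frontier subtrees [Y j] and [Y l], and
    both project to the same point [p] of the neighborhood. The median of [a],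
    [b] and [p] is in all three subtrees, which bounds both halves by [L]. *)
Lemma thickening_thin i a b : ~ A' i -> V a -> V b -> Y i a -> Y i b ->
  d a b <= 2 * L.
Proof.
move=> nA'i Va Vb Ya Yb.
have root x : V x -> Y i x ->
    exists j p, [/\ R j, Y j x, Y j p & gate d (nbhd d W) x p].
  move=> [Wx Yx|[j [Rj Yjx]] Yx]; first by case: nA'i; exact: nbhd_index Wx Yx.
  have [_ [o [Wo Yo]]] := Rj.
  have [p xp] := gate_exists tree x nbhdW_convex Wo.
  by exists j, p; split=> //; exact: gate_in (fam_convex fam (i := j)) Yjx Yo Wo xp.
have [j [p [Rj Yja Yjp ap]]] := root _ Va Ya.
have [l [q [Rl Ylb Ylq bq]]] := root _ Vb Yb.
have [pq|pq] := pselect (p = q); last first.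
  have [pab _] := gate_between tree ap bq pq.
  case: nA'i; apply: (nbhd_index ap.1); exact: fam_convex fam _ _ _ _ Ya Yb pab.
rewrite -{q}pq in Ylq bq.
have [m [mab mbp map]] := tree_median tree a b p.
have Yim : Y i m by exact: fam_convex fam _ _ _ _ Ya Yb mab.
have ij : i <> j by move=> ij; apply: nA'i; rewrite ij; exact: frontier_next.
have il : i <> l by move=> il; apply: nA'i; rewrite il; exact: frontier_next.
have am := fam_overlap fam ij Ya Yim Yja (fam_convex fam Yja Yjp map).
have mb := fam_overlap fam il Yim Yb (fam_convex fam Ylb Ylq mbp) Ylb.
by move: mab; rewrite /between; lia.
Qed.

(** If [a] is in the subtree [Y j] of the first syllable, undoing that syllable
    shortens the product. Otherwise [a] projects near the overlap of [Y j], and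
    [k * b], unless it is in the thickening, projects far from it; a subtree
    through both points would then overlap [Y j] by more than [L]. *)
Lemma syllables_thin o k i a b : syllables R o k -> ~ A' i -> V a -> V b ->
  Y i a -> Y i (k * b) -> d a (k * b) <= 2 * L.
Proof.
move=> sk; elim: (sk) i a b => {o k sk} [|j n o k Rj Nn n1 sk IH oj] i a b nA'i Va Vb Ya.
  by rewrite mul1g; exact: thickening_thin.
move=> Yb; have snk : syllables R (Some j) (n * k) by exact: syl_cons sk oj.
have ij : i <> j by move=> ij; apply: nA'i; rewrite ij; exact: frontier_next.
have Yjrot x m : N j m -> Y j x -> Y j (m * x).
  by move=> Nm Yx; rewrite -(rot_stab fam Nm); exact: fam_act fam _ _ _ Yx.
have [Yja|nYja] := pselect (Y j a).
  have Nn' : N j n^-1 by have [_ _] := rot_group fam j; apply.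
  rewrite -(distM tree n^-1) -mulgA mulKg; apply: (IH (act n^-1 i)) => //.
  - exact (next_index_actV (next_group_rot Rj Nn) nA'i).
  - by right; exists j; split=> //; exact: Yjrot.
  - exact: fam_act fam _ _ _ Ya.
  - by move/(fam_act fam n^-1): Yb; rewrite -mulgA mulKg.
have neara : near j a.
  case: Va => [Wa|[l [Rl Yla]]]; first exact: nbhd_near.
  have jl : j <> l by move=> jl; rewrite -jl in Yla.
  exact: fam_near Rj Rl jl Yla.
have [[q [bq farq]]|Yjb] := pong snk erefl Vb; last first.
  by apply: (thickening_thin nA'i Va _ Ya Yb); right; exists j.
have [p [o' [ap Oo' o'p]]] := neara.
have o'q := farq _ Oo'.
have pqL : L < d p q by have := dist_triangle tree o' p q; lia.
have pq : p <> q by move=> pq; move: pqL; rewrite pq (distxx tree).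
have [pab qab] := gate_between tree ap bq pq.
have := fam_overlap fam ij (fam_convex fam Ya Yb pab) (fam_convex fam Ya Yb qab) ap.1 bq.1.
by rewrite leqNgt pqL.
Qed.

Lemma next_thin i x y : ~ A' i -> W' x -> W' y -> Y i x -> Y i y -> d x y <= 2 * L.
Proof.
move=> nA'i [g [a [G'g Va ->]]] [h [b [G'h Vb ->]]] Ya Yb.
have [o [k [l [sk Gl ghE]]]] := next_groupM (next_groupV G'g) G'h.
rewrite -(distM tree g^-1) mulKg mulgA ghE -mulgA.
apply: (syllables_thin sk (next_index_actV G'g nA'i)) => //.
- exact: thickening_act.
- by move/(fam_act fam g^-1): Ya; rewrite mulKg.
- by move/(fam_act fam g^-1): Yb; rewrite mulgA ghE -mulgA.
Qed.

(** Such an element preserves the overlap, which is bounded, whereas nontrivial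
    elements have unbounded powers. *)
Lemma frontier_stab_trivial i g : R i -> G g -> act g i = i -> g = 1.
Proof.
move=> Ri Gg gi; have [_ [o Oo]] := Ri.
have Ogm m : overlap i (g ^+ m * o).
  elim: m => [|m [Wm Ym]]; first by rewrite expg0 mul1g.
  rewrite expgS -mulgA; split; first exact: nbhd_act.
  by rewrite -gi; exact: fam_act fam _ _ _ Ym.
have [//|g1] := pselect (g = 1).
have go1 : g ^ o <> 1 by move/eqP; rewrite conjg_eq1 => /eqP.
have [m] := dist_expg_unbounded tree (2 * L + 3) go1.
rewrite -conjXg -dist1M // => /leq_trans/(_ (overlap_diam Ri Oo (Ogm m))).
by rewrite leq_add2l.
Qed.

(** A nonempty reduced product would carry the points of [Y j], which are in [W],
    to far points, which are not. *)
Lemma stab_faithful_index j g : A j -> G' g -> act g j = j -> N j g.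
Proof.
move=> Aj [o [k [h [sk Gh ->]]]] khj; have [x Yx] := fam_nonempty fam j.
have Whx : nbhd d W (h * x).
  by apply: sub_nbhd => //; apply: (wm_tree_act wm) => //; exact: (wm_fam_sub wm Aj).
have Wkhx : nbhd d W (k * (h * x)).
  apply: sub_nbhd => //; apply: (wm_fam_sub wm Aj); rewrite -khj mulgA.
  exact: fam_act fam _ _ _ Yx.
case: o sk => [i|] sk; last first.
  have k1 : k = 1 by inversion sk.
  by move: khj; rewrite k1 mul1g => hj; exact: (wm_faithful wm).
case: (nbhd_not_far (syllables_frontier sk) Wkhx).
exact: pong_nbhd sk erefl Whx.
Qed.

(** A nonempty reduced product carries [Y j] into far points, and no frontier
    subtree consists of far points, unless it is a single rotation about [Y j]
    itself. *)
Lemma stab_faithful_frontier j g : R j -> G' g -> act g j = j -> N j g.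
Proof.
move=> Rj [o [k [h [sk Gh ->]]]] khj.
have N1 i : N i 1 by case: (rot_group fam i).
case: o sk => [i|] sk; last first.
  have k1 : k = 1 by inversion sk.
  by move: khj; rewrite k1 mul1g => /(frontier_stab_trivial Rj Gh)->.
have [farY|[hji Nk]] := pong_fam sk erefl (frontier_act Gh Rj).
  have [_ [c [Wc Yc]]] := Rj.
  case: (nbhd_not_far (syllables_frontier sk) Wc).
  have <- : k * (k^-1 * c) = c by rewrite mulVKg.
  by apply: farY; apply: fam_actV; rewrite -(actM fam) khj.
have ji : i = j by rewrite -khj (actM fam) hji (rot_stab fam Nk).
rewrite {}ji in hji Nk sk.
by rewrite (frontier_stab_trivial Rj Gh hji) mulg1.
Qed.

Lemma next_faithful i g : A' i -> G' g -> act g i = i -> N i g.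
Proof.
move=> [h [j [G'h Aj ->]]] G'g ghj.
have stab : act (g ^ h) j = j by rewrite conjgE !(actM fam) ghj actK.
have G'gh : G' (g ^ h).
  by rewrite conjgE; apply: next_groupM; [exact: next_groupV|exact: next_groupM].
rewrite -[g](conjgK h); apply: (rot_act fam).
by case: Aj => Aj; [exact: stab_faithful_index|exact: stab_faithful_frontier].
Qed.

Lemma next_windmill : windmill W' G' A'.
Proof.
split.
- exact: next_tree_convex.
- apply: thickening_next_tree; left; apply: sub_nbhd => //; exact: wm_one wm.
- exact: next_group_subgroup.
- exact: next_tree_act.
- exact: next_index_act.
- move=> _ [g [j [G'g Aj ->]]] x /fam_actV Yx; rewrite -[x](mulVKg g).
  apply: next_tree_act => //; apply: thickening_next_tree.
  case: Aj => [Aj|Rj]; last by right; exists j.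
  by left; apply: sub_nbhd => //; exact: (wm_fam_sub wm Aj).
- move=> _ [g [j [G'g Aj ->]]] n /(rot_act fam g^-1); rewrite actK invgK => Nn.
  rewrite -[n](conjgK g) conjgE invgK.
  apply: next_groupM => //; apply: next_groupM; last exact: next_groupV.
  case: Aj => [Aj|Rj]; last exact: next_group_rot Rj Nn.
  exact/next_groupG/(wm_rot_sub wm Aj).
- exact: next_thin.
- exact: next_faithful.
Qed.

End Step.

Definition next (w : set F * set F * set I) : set F * set F * set I :=
  (next_tree w.1.1 w.1.2 w.2, next_group w.1.1 w.1.2 w.2, next_index w.1.1 w.1.2 w.2).

(** The first windmill is a single vertex with the trivial group. *)
Definition stage n := iter n next ([set 1], [set 1], set0).

Lemma stage_windmill n : windmill (stage n).1.1 (stage n).1.2 (stage n).2.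
Proof.
elim: n => [|n IH]; last exact: next_windmill.
split=> //=.
- move=> x y u -> ->; rewrite /between (distxx tree) => /eqP.
  by rewrite addn_eq0 => /andP[/eqP/(dist_eq0 tree)<-].
- by split=> // [x y -> ->|x ->]; rewrite ?mulg1 ?invg1.
- by move=> g x -> ->; rewrite mulg1.
- by move=> i x y _ -> -> _ _; rewrite (distxx tree).
Qed.

Lemma stage_tree n x : d 1 x <= n -> (stage n).1.1 x.
Proof.
elim: n x => [|n IH] x; first by rewrite leqn0 => /eqP/(dist_eq0 tree) <-.
move=> xn; apply: (thickening_next_tree (stage_windmill n)); left.
have [xn'|nx] := leqP (d 1 x) n; first by apply: (sub_nbhd tree); exact: IH.
have xE : d 1 x = n.+1 by apply/eqP; rewrite eqn_leq xn.
have [z [z1 zx]] := tree_step tree xE.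
by exists z; split; [apply: IH; rewrite z1|rewrite zx].
Qed.

Lemma stage_index i : exists n, (stage n).2 i.
Proof.
have [x Yx] := fam_nonempty fam i; exists (d 1 x).+1.
apply: (nbhd_index (stage_windmill _) _ Yx).
by apply: sub_nbhd => //; exact: stage_tree.
Qed.

Lemma stage_mono m n : m <= n ->
  (stage m).1.2 `<=` (stage n).1.2 /\ (stage m).2 `<=` (stage n).2.
Proof.
elim: n => [|n IH]; first by rewrite leqn0 => /eqP->; split.
rewrite leq_eqVlt ltnS => /orP[/eqP->|/IH[GG AA]]; first by split.
split=> x.
- by move=> /GG; exact: next_groupG.
- by move=> /AA; exact: (index_next (stage_windmill n)).
Qed.

Inductive rotations : F -> Prop :=
| rotations1 : rotations 1
| rotationsM i n x : N i n -> rotations x -> rotations (n * x).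

(** A product of rotations and the subtree [Y i] both appear at some stage, hence
    at a common one, where faithfulness applies. *)
Theorem rotations_faithful i g : rotations g -> act g i = i -> N i g.
Proof.
move=> rg; suff [n Gg] : exists n, (stage n).1.2 g.
  have [m Ai] := stage_index i.
  have [Gn _] := stage_mono (leq_maxl n m); have [_ Am] := stage_mono (leq_maxr n m).
  by move=> gi; exact (wm_faithful (stage_windmill (maxn n m)) (Am _ Ai) (Gn _ Gg) gi).
elim: rg => {g} [|j n g Nn _ [m Gg]].
  by exists 0; case: (wm_group (stage_windmill 0)).
have [l Aj] := stage_index j; exists (maxn m l).
have [Gm _] := stage_mono (leq_maxl m l); have [_ Al] := stage_mono (leq_maxr m l).
have wm := stage_windmill (maxn m l).
exact (wm_groupM wm (wm_rot_sub wm (Al _ Aj) Nn) (Gm _ Gg)).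
Qed.

End Windmill.

Section NormalRotations.
Variables (F : groupType) (L : nat) (d : F -> F -> nat) (I : Type).
Variables (act : F -> I -> I) (Y N : I -> set F).
Hypothesis fam : tree_family d L act Y N.

Lemma rotations_mul x y : rotations N x -> rotations N y -> rotations N (x * y).
Proof.
move=> rx ry; elim: rx => [|i n x' Nn _ IH]; first by rewrite mul1g.
by rewrite -mulgA; exact: rotationsM Nn IH.
Qed.

Lemma rotations_of i n : N i n -> rotations N n.
Proof. by move=> Nn; rewrite -[n]mulg1; apply: rotationsM Nn _; exact: rotations1. Qed.

Lemma rotations_normal : is_normal (rotations N) [set: F].
Proof.
split=> //.
  split; [exact: rotations1|exact: rotations_mul|move=> x rx].
  elim: rx => [|i n {}x Nn _ IH]; first by rewrite invg1; exact: rotations1.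
  rewrite invgM; apply: rotations_mul IH _; apply: (@rotations_of i).
  by have [_ _] := rot_group fam i; apply.
move=> x g rx _; elim: rx => [|i n {}x Nn _ IH].
  by rewrite conj1g; exact: rotations1.
have := rot_act fam g^-1 Nn; rewrite invgK conjMg => Nng.
exact: rotationsM Nng IH.
Qed.

End NormalRotations.

(** * The translates of the hull of a malnormal subgroup *)

Section Cosets.
Variables (F : groupType) (d : F -> F -> nat).
Hypothesis tree : tree_metric d.
Variable H : set F.
Hypotheses (subH : is_subgroup H) (malH : malnormal H).

Let H1 : H 1. Proof. by case: subH. Qed.
Let HM x y : H x -> H y -> H (x * y). Proof. by case: subH => _ h _; exact: h. Qed.
Let HV x : H x -> H x^-1. Proof. by case: subH => _ _; apply. Qed.

Definition hull (C : set F) : set F :=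
  fun z => exists x y, [/\ C x, C y & between d z x y].

(** Geodesics between points of the hull are covered by three geodesics that end
    in [C]. *)
Lemma hull_convex C : convex d (hull C).
Proof.
move=> x y u [a [b [Ca Cb xab]]] [c [e [Cc Ce yce]]] uxy.
case: (tree_split tree a uxy) => [uxa|uay].
  have [_ uab] := between_trans tree xab (between_sym tree uxa).
  by exists a, b.
case: (tree_split tree c uay) => [uac|ucy]; first by exists a, c.
by have [_ uce] := between_trans tree yce ucy; exists c, e.
Qed.

(** Cosets are taken as sets, so that two indices are equal when the cosets are,
    whatever their representatives. *)
Definition left_coset := {i : set F | exists a, forall x, i x <-> H (a^-1 * x)}.

Implicit Types i j : left_coset.

Lemma left_coset_ext i j : (forall x, sval i x <-> sval j x) -> i = j.
Proof.
case: i j => [i iP] [j jP] /= ij.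
by apply: eq_exist; apply/funext => x; exact/propext/ij.
Qed.

Lemma left_cosetE i a : sval i a -> forall x, sval i x <-> H (a^-1 * x).
Proof.
case: i => i [b iP] /= /iP ba x; rewrite iP.
have -> : b^-1 * x = (b^-1 * a) * (a^-1 * x) by rewrite -!mulgA mulVKg.
split=> [bx|ax]; last exact: HM.
by rewrite -(mulKg (b^-1 * a) (a^-1 * x)); apply: HM => //; exact: HV.
Qed.

Lemma left_coset_inhab i : exists a, sval i a.
Proof. by case: i => i [a iP]; exists a; rewrite /= iP mulVg. Qed.

Lemma translate_subproof g i :
  exists a, forall x, sval i (g^-1 * x) <-> H (a^-1 * x).
Proof.
have [a ia] := left_coset_inhab i; exists (g * a) => x.
by rewrite invgM -mulgA; exact: left_cosetE.
Qed.

Definition translate g i : left_coset := exist _ _ (translate_subproof g i).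

Lemma base_subproof : exists a, forall x, H x <-> H (a^-1 * x).
Proof. by exists 1 => x; rewrite invg1 mul1g. Qed.

Definition base_coset : left_coset := exist _ H base_subproof.

Variable U : seq F.
Hypothesis hullHU : forall z, hull H z -> exists k u, [/\ H k, u \in U & z = k * u].

Lemma hull_translate g i z : hull (sval i) z -> hull (sval (translate g i)) (g * z).
Proof.
move=> [x [y [ix iy zxy]]]; exists (g * x), (g * y).
by rewrite /= !mulKg; split=> //; apply/(betweenM tree).
Qed.

Lemma hull_coset i z : hull (sval i) z ->
  exists b u, [/\ sval i b, u \in U & z = b * u].
Proof.
have [a ia] := left_coset_inhab i; move=> /(hull_translate a^-1)[x [y [/= ix iy zxy]]].
have toH w : sval i (a^-1^-1 * w) -> H w by rewrite invgK => /(left_cosetE ia); rewrite mulKg.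
have [|k [u [Hk Uu zE]]] := @hullHU (a^-1 * z); first by exists x, y; split=> //; exact: toH.
exists (a * k), u; split=> //; first by rewrite (left_cosetE ia) mulKg.
by rewrite -mulgA -zE mulVKg.
Qed.

(** Each point [z] of the common segment is written [b * u] and [c * v] with [b]
    in one coset, [c] in the other and [u], [v] in [U]. On a segment with more
    than [size U ^ 2] points two of them, [z] and [w], have the same pair
    [(u, v)]; then [z * w^-1] is a nontrivial element of the two conjugates of
    [H] attached to the cosets. *)
Lemma coset_overlap i j x y : i <> j ->
  hull (sval i) x -> hull (sval i) y -> hull (sval j) x -> hull (sval j) y ->
  d x y <= size U * size U.
Proof.
move=> ij ix iy jx jy; rewrite leqNgt; apply/negP => big.
pose P (k : 'I_(d x y).+1) (p : F * F) := [/\ p.1 \in U, p.2 \in U &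
  exists z, [/\ d x z = k, sval i (z * p.1^-1) & sval j (z * p.2^-1)]].
have /choice[f fP] : forall k, exists p, P k p.
  move=> k; have kxy : k <= d x y by rewrite -ltnS ltn_ord.
  have [z [xz zxy]] := geodesic_point tree kxy.
  have [b [u [ib Uu zb]]] := hull_coset (hull_convex ix iy zxy).
  have [c [v [jc Uv zc]]] := hull_coset (hull_convex jx jy zxy).
  by exists (u, v); split=> //; exists z; split=> //=; [rewrite zb mulgK|rewrite zc mulgK].
have [/injectiveP inj_f|/injectivePn[k [l kl fkl]]] := boolP (injectiveb f).
  have : size (map f (enum 'I_(d x y).+1)) <= size (allpairs pair U U).
    apply: uniq_leq_size; first by rewrite map_inj_uniq ?enum_uniq.
    move=> _ /mapP[k _ ->]; have [Uu Uv _] := fP k.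
    by rewrite [f k]surjective_pairing; apply: allpairs_f.
  by rewrite size_map -cardE card_ord size_allpairs; lia.
have [_ _ [z [xz iz jz]]] := fP k; have [_ _ [w [xw iw jw]]] := fP l.
move: iw jw; rewrite -fkl; set u := (f k).1; set v := (f k).2 => iw jw.
have cu : H ((z * w^-1) ^ (w * u^-1)).
  move/(left_cosetE iw): iz; congr H.
  by rewrite conjgE !invgM !invgK !mulgA mulgVK -/u.
have cv : H ((z * w^-1) ^ (w * v^-1)).
  move/(left_cosetE jw): jz; congr H.
  by rewrite conjgE !invgM !invgK !mulgA mulgVK -/v.
have nHg : ~ H ((w * u^-1)^-1 * (w * v^-1)).
  move=> Hg; apply: ij; apply: left_coset_ext => t.
  have iv : sval i (w * v^-1) by apply/(left_cosetE iw).
  by rewrite (left_cosetE iv) (left_cosetE jw).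
have : [set 1] ((z * w^-1) ^ (w * v^-1)).
  rewrite -(malH nHg); split=> //; exists ((z * w^-1) ^ (w * u^-1)) => //.
  by rewrite -conjgM mulVKg.
move=> /eqP; rewrite conjg_eq1 => /eqP/divg1_eq zw.
by case/eqP: kl; apply: val_inj; rewrite /= -xz -xw zw.
Qed.

Variables (K : set F).
Hypothesis normK : is_normal K H.

Definition coset_rotations i : set F := fun n => exists a, sval i a /\ K (n ^ a).

Let subK : is_subgroup K. Proof. by case: normK. Qed.
Let KJ n h : K n -> H h -> K (n ^ h). Proof. by case: normK => _ _; apply. Qed.

Lemma coset_rotationsE i a n : sval i a -> coset_rotations i n <-> K (n ^ a).
Proof.
move=> ia; split=> [[b [ib Kn]]|Kn]; last by exists a.
have := KJ Kn ((left_cosetE ib a).1 ia).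
by rewrite -conjgM mulVKg.
Qed.

(** Every point of a translate of the hull has the form [b * u], and a rotation
    [n] moves it by the distance from [1] to [(n ^ b) ^ u]. *)
Hypothesis dispK : forall n u, K n -> n <> 1 -> u \in U ->
  5 * (size U * size U) + 2 < d 1 (n ^ u).

Lemma coset_family :
  tree_family d (size U * size U) translate (fun i => hull (sval i)) coset_rotations.
Proof.
split.
- by move=> i; apply: left_coset_ext => x; rewrite /= invg1 mul1g.
- by move=> g h i; apply: left_coset_ext => x; rewrite /= invgM mulgA.
- by move=> i; exact: hull_convex.
- move=> i; have [a ia] := left_coset_inhab i; exists a, a, a.
  by rewrite /between (distxx tree).
- by move=> g i x; exact: hull_translate.
- exact: coset_overlap.
- move=> i; have [a ia] := left_coset_inhab i; have [K1 KM KV] := subK.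
  split; first by rewrite (coset_rotationsE _ ia) conj1g.
    by move=> x y; rewrite !(coset_rotationsE _ ia) conjMg; exact: KM.
  by move=> x; rewrite !(coset_rotationsE _ ia) conjVg; exact: KV.
- move=> g i n [a [ia Kn]]; exists (g * a); rewrite /= mulKg; split=> //.
  by rewrite -conjgM mulKg.
- move=> i n [a [ia Kn]]; apply: left_coset_ext => x /=.
  have Hn : H (n ^ a) by case: normK => _ + _; apply.
  have Hn' := HV Hn; rewrite !(left_cosetE ia).
  have -> : a^-1 * (n^-1 * x) = (n ^ a)^-1 * (a^-1 * x).
    by rewrite conjgE !invgM invgK -!mulgA mulVKg.
  split=> ax; last exact: HM.
  by rewrite -(mulVKg (n ^ a) (a^-1 * x)); exact: HM.
- move=> i n x Nn n1 /hull_coset[b [u [ib Uu ->]]].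
  rewrite (dist1M tree) conjgM; apply: dispK => //.
    exact/(coset_rotationsE _ ib).
  by move/eqP; rewrite conjg_eq1 => /eqP.
Qed.

(** The rotations generate a normal subgroup containing [K], and elements of [H]
    stabilize the base coset. *)
Lemma normal_closure_cap : H `&` normal_closure K = K.
Proof.
have KH : K `<=` H by case: normK.
apply/seteqP; split=> [h [Hh Kh]|k Kk]; last first.
  by split; [exact: KH|move=> M [_]; apply].
have rot_h : rotations coset_rotations h.
  apply: Kh; split; first exact: rotations_normal coset_family.
  move=> k Kk; apply: (@rotations_of _ _ _ base_coset).
  by apply/(@coset_rotationsE base_coset 1) => //=; rewrite conjg1.
have stab_h : translate h base_coset = base_coset.
  apply: left_coset_ext => x /=; split=> [hx|]; last by apply: HM; exact: HV.
  by rewrite -(mulVKg h x); exact: HM.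
have := rotations_faithful tree coset_family rot_h stab_h.
by move/(@coset_rotationsE base_coset 1 h H1); rewrite conjg1.
Qed.

End Cosets.

(** * Finitely generated subgroups *)

Section FiniteGeneration.
Variables (F : groupType) (B : set F) (nf : F -> seq (letter B)).
Hypothesis nf_reduced : forall x, reduced (nf x).
Hypothesis nfK : forall x, word (nf x) = x.
Hypothesis wordK : forall w, reduced w -> nf (word w) = w.

Local Notation d := (wdist nf).
Let tree : tree_metric d := wdist_tree nf_reduced nfK wordK.

Variable s : seq F.
Local Notation H := (subgroup_generated [set` s]).

Lemma generated_subgroup : is_subgroup H.
Proof.
split; first by move=> M [[M1 _ _] _].
  move=> x y Hx Hy M MS; have [[_ MM _] _] := MS.
  by apply: MM; [exact: Hx|exact: Hy].
by move=> x Hx M MS; have [[_ _ MV] _] := MS; apply: MV; exact: Hx.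
Qed.

Lemma generator x : x \in s -> H x.
Proof. by move=> sx M [_]; apply. Qed.

Definition prefixes : seq F :=
  1 :: [seq word (take k (nf x)) | x <- s, k <- iota 0 (wlen nf x).+1].

Lemma prefixesP x u : x \in s -> between d u 1 x -> u \in prefixes.
Proof.
move=> sx ux; have := ux; rewrite /between !wdist1 // => len.
rewrite (between_prefix nf_reduced nfK wordK ux) inE.
apply/orP; right; apply/allpairsPdep; exists x, (wlen nf u); split=> //.
by rewrite mem_iota /= add0n ltnS -len leq_addr.
Qed.

(** The elements [h] such that the geodesic from [1] to [h] is covered by
    translates of [prefixes] under [H] form a subgroup, as geodesic triangles
    are tripods; it contains the generators. *)
Lemma hull_generated z : hull d H z ->
  exists k u, [/\ H k, u \in prefixes & z = k * u].
Proof.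
have [H1 HM HV] := generated_subgroup.
pose P := fun h => H h /\ forall z, between d z 1 h ->
  exists k u, [/\ H k, u \in prefixes & z = k * u].
have HP : H `<=` P.
  move=> h; apply; split; last first.
    move=> x sx; split=> [|u ux]; first exact: generator.
    by exists 1, u; rewrite mul1g; split=> //; exact: prefixesP ux.
  split.
  - split=> // u; rewrite /between (distxx tree) => /eqP.
    rewrite addn_eq0 => /andP[/eqP/(dist_eq0 tree)<- _].
    by exists 1, 1; rewrite mul1g; split=> //; exact: mem_head.
  - move=> x y [Hx Px] [Hy Py]; split=> [|u]; first exact: HM.
    case/(tree_split tree x) => [/Px//|].
    rewrite -{1}[x]mulg1 -{1}[u](mulVKg x) => /(betweenM tree)/Py[k [v [Hk Uv uE]]].
    by exists (x * k), v; rewrite -mulgA -uE mulVKg; split=> //; exact: HM.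
  - move=> x [Hx Px]; split=> [|u]; first exact: HV.
    rewrite -(betweenM tree x) mulg1 mulgV => /(between_sym tree)/Px.
    move=> [k [v [Hk Uv uE]]]; exists (x^-1 * k), v.
    by rewrite -mulgA -uE mulKg; split=> //; apply: HM => //; exact: HV.
move=> [x [y [Hx Hy zxy]]].
have [|k [u [Hk Uu zE]]] := (HP _ (HM _ _ (HV _ Hx) Hy)).2 (x^-1 * z).
  by rewrite -(mulVg x); apply/(betweenM tree).
by exists (x * k), u; rewrite -mulgA -zE mulVKg; split=> //; exact: HM.
Qed.

Definition alphabet : seq (letter B) :=
  let a := flatten (map nf s) in a ++ map (@flip F B) a.

Lemma alphabet_flip a : (flip a \in alphabet) = (a \in alphabet).
Proof.
have flip_inj := inv_inj (@flipK F B).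
rewrite !mem_cat (mem_map flip_inj) orbC; congr orb.
by rewrite -{2}[a]flipK (mem_map flip_inj).
Qed.

(** The letters of the generators and their inverses suffice to write all of [H],
    even when the basis is infinite; this makes balls of [H] finite. *)
Lemma generated_alphabet h : H h -> all (mem alphabet) (nf h).
Proof.
pose P : set F := fun x => all (mem alphabet) (nf x).
move=> Hh; suff: P h by []; apply: Hh; split; last first.
  move=> x sx; apply/allP => a xa; rewrite /= mem_cat; apply/orP; left.
  by apply/flattenP; exists (nf x) => //; exact: map_f.
split; first by rewrite /P nf1.
- move=> x y /allP Px /allP Py; apply/allP => a /(mem_nfM nf_reduced nfK wordK)/orP[].
    exact: Px.
  exact: Py.
- move=> x /allP Px; apply/allP => a.
  by rewrite (mem_nfV nf_reduced nfK wordK) => /Px /=; rewrite alphabet_flip.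
Qed.

Fixpoint short_words (T : Type) (A : seq T) m : seq (seq T) :=
  if m is m'.+1 then [::] :: [seq a :: w | a <- A, w <- short_words A m'] else [:: [::]].

Lemma mem_short_words (T : eqType) (A : seq T) m w :
  all (mem A) w -> size w <= m -> w \in short_words A m.
Proof.
elim: m w => [|m IH] [|a w] //= /andP[Aa Aw] wm; rewrite inE /=.
by apply: (allpairs_f cons) => //; exact: IH.
Qed.

Lemma generated_ball_finite m : finite_set [set h | H h /\ d 1 h <= m].
Proof.
apply: (@sub_finite_set _ _ [set` map (@word F B) (short_words alphabet m)]).
  move=> h [Hh hm] /=; rewrite -[h]nfK; apply: map_f; apply: mem_short_words.
    exact: generated_alphabet.
  by rewrite -/(wlen nf h) -wdist1.
exact: finite_seq.
Qed.

End FiniteGeneration.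

(** * Almost CEP *)

Theorem corollary1p5 (F : groupType) (H : set F)
  (freeF : free_group F) (subH : is_subgroup H)
  (fgH : finitely_generated H) (malH : malnormal H) :
  almost_CEP H.
Proof.
have [B freeB] := freeF; have [nf [nf_red nfK wordK]] := reduced_form freeB.
have tree := wdist_tree nf_red nfK wordK; pose d := wdist nf.
have [S [/finite_seqP[s ->] HE]] := fgH.
pose U := prefixes nf s; pose M := 5 * (size U * size U) + 2.
pose E := [set e | [/\ H e, e <> 1 & exists2 u, u \in U & d 1 (e ^ u) <= M]].
exists E; split=> [|e []//|[]//|K normK KE].
  (* conjugation by u changes the length by at most twice the length of u *)
  pose r := \max_(u <- U) d 1%g u.
  apply: sub_finite_set (generated_ball_finite nf_red nfK wordK s (r + M + r)).
  move=> e [He _ [u Uu euM]]; rewrite -HE; split=> //.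
  have ur : d 1 u <= r by exact: (leq_bigmax_seq u).
  have := dist_triangle tree 1 u e; have := dist_triangle tree u (e * u) e.
  have -> : wdist nf (e * u) e = wdist nf 1 u.
    by rewrite -{2}[e]mulg1 (distM tree) (dist_sym tree).
  by rewrite (dist1M tree); move: euM ur; rewrite /d; lia.
have hullU z : hull d H z -> exists k u, [/\ H k, u \in U & z = k * u].
  by rewrite HE; exact: hull_generated.
apply: (normal_closure_cap tree subH malH hullU normK) => n u Kn n1 Uu.
rewrite ltnNge; apply/negP => nuM.
have : (K `&` E) n; last by rewrite KE.
by split=> //; split=> //; [case: normK => _ + _; apply|exists u].
Qed.
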